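(* Let $n\ge 2$. Suppose the marginal probabilities equal $p\in(0,1/(n-1)]$ for $n-1$ of the random variables and $q\in(0,1)$ for the remaining one, and let $k\le n$ be an integer. Let $\overline{P}(n,k,p,q)$ be the tightest upper bound on the probability that $n$ pairwise independent Bernoulli random variables with these marginals add up to at least $k$. Then in each of the following three instances both the ordered Schmidt, Siegel and Srinivasan bound and the ordered Boros and Prékopa bound are tight (equal to $\overline{P}(n,k,p,q)$), and $$\overline{P}(n,k,p,q)=\begin{cases}\dfrac{\binom{n-1}{2}p^2}{\binom{k-1}{2}}, & k\ge 3,\ q\ge(n-2)p, & \text{(a)}\\[3mm] \dfrac{\binom{n-1}{2}p^2}{\binom{k-1}{2}}, & k\in\left[\left\lceil 2+(n-2)p/q\right\rceil,\,n\right],\ p\le q<(n-2)p, & \text{(b)}\\[3mm] pq, & k=n,\ 0<q<p. & \text{(c)}\end{cases}$$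
   Context: For integers $a\le b$, $[a,b]=\{a,a+1,\ldots,b\}$; $K_m=\{(i,j):1\le i<j\le m\}$ (empty for $m=1$); $\lceil x\rceil$ is the smallest integer $\ge x$. $\overline{P}(n,k,p,q)$ is the maximum of $\mathbb{P}_\theta\left(\sum_{i=1}^n\tilde c_i\ge k\right)$ over all probability distributions $\theta$ of $(\tilde c_1,\ldots,\tilde c_n)$ on $\{0,1\}^n$ with $\mathbb{P}_\theta(\tilde c_i=1)=p$ for $i\le n-1$, $\mathbb{P}_\theta(\tilde c_n=1)=q$, $\mathbb{P}_\theta(\tilde c_i=1,\tilde c_j=1)=p^2$ for $1\le i<j\le n-1$, and $\mathbb{P}_\theta(\tilde c_i=1,\tilde c_n=1)=pq$ for $i\le n-1$. Ordered bounds: let $\pi_1\le\cdots\le\pi_n$ be the $n$ marginal probabilities sorted in increasing order, and let $S_{1r}=\sum_{i=1}^{n-r}\pi_i$, $S_{2r}=\sum_{(i,j)\in K_{n-r}}\pi_i\pi_j$ for $r\in[0,n-1]$ (so $S_{2,n-1}=0$). For $k\in[2,n]$, the ordered Schmidt, Siegel and Srinivasan bound is $$\min\left(1,\ \min_{r_1\in[0,k-1]}\frac{S_{1r_1}}{k-r_1},\ \min_{r_2\in[0,k-2]}\frac{S_{2r_2}}{\binom{k-r_2}{2}}\right),$$ and the ordered Boros and Prékopa bound is $\min_{r\in[0,k-1]}BP(n-r,k-r)$, where $$BP(n-r,k-r)=\begin{cases}1, & k<\dfrac{(n-r-1)S_{1r}-2S_{2r}}{n-r-S_{1r}}+r,\\[2mm]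 \dfrac{(k+n-2r-1)S_{1r}-2S_{2r}}{(k-r)(n-r)}, & \dfrac{(n-r-1)S_{1r}-2S_{2r}}{n-r-S_{1r}}+r\le k<1+\dfrac{2S_{2r}}{S_{1r}}+r,\\[2mm] \dfrac{(i-1)(i-2S_{1r})+2S_{2r}}{(k-r-i)^2+(k-r-i)}, & k\ge 1+\dfrac{2S_{2r}}{S_{1r}}+r,\end{cases}$$ with $i=\left\lceil\dfrac{(k-r-1)S_{1r}-2S_{2r}}{k-r-S_{1r}}\right\rceil$. *)

(* Defs.v *)
From mathcomp Require Import all_boot all_order all_algebra.
From mathcomp Require Import boolp classical_sets reals.

Set Implicit Arguments.
Unset Strict Implicit.
Unset Printing Implicit Defensive.

Import Order.TTheory GRing.Theory Num.Theory.
Local Open Scope classical_set_scope.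
Local Open Scope ring_scope.

Section PairwiseIndependence.
Variables (R : realType) (n : nat).

(* A joint distribution of n Bernoulli variables is given by its mass function
   [theta] on {0,1}^n. *)
Local Notation outcome := {ffun 'I_n -> bool}.

Definition prob (theta : {ffun outcome -> R}) (E : pred outcome) : R :=
  \sum_(c | E c) theta c.

Definition is_distribution (theta : {ffun outcome -> R}) : Prop :=
  (forall c, 0 <= theta c) /\ \sum_c theta c = 1.

Definition pairwise_indep_with (marg : 'I_n -> R)
    (theta : {ffun outcome -> R}) : Prop :=
  [/\ is_distribution theta,
      forall i, prob theta (fun c => c i) = marg i
    & forall i j : 'I_n, (i < j)%N ->
        prob theta (fun c => c i && c j) = marg i * marg j].

Definition tail_prob (k : nat) (theta : {ffun outcome -> R}) : R :=
  prob theta (fun c => (k <= \sum_(i < n) c i)%N).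

Definition tail_probs (marg : 'I_n -> R) (k : nat) : set R :=
  [set tail_prob k theta | theta in pairwise_indep_with marg].

End PairwiseIndependence.

(* p for the first n - 1 variables, q for the last one *)
Definition marg_pq (R : realType) (n : nat) (p q : R) (i : 'I_n) : R :=
  if i == n.-1 :> nat then q else p.

Definition is_max (R : realType) (A : set R) (v : R) : Prop :=
  A v /\ ubound A v.

(* A supremum, hence total; it is a maximum when
   [is_max (tail_probs (marg_pq p q) k) (Pbar n k p q)], which is part of
   [both_tight_with_value] below. *)
Definition Pbar (R : realType) (n k : nat) (p q : R) : R :=
  sup (tail_probs (@marg_pq R n p q) k).

Section OrderedBounds.
Variables (R : realType) (n : nat) (marg : 'I_n -> R).

(* [sorted_marg`_i] is pi_(i+1) *)
Definition sorted_marg : seq R := sort <=%R [seq marg i | i <- enum 'I_n].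

Definition S1 (r : nat) : R := \sum_(i < n - r) sorted_marg`_i.

Definition S2 (r : nat) : R :=
  \sum_(i < n - r) \sum_(j < n - r | (i < j)%N) sorted_marg`_i * sorted_marg`_j.

(* The subtractions on nat below never truncate when 2 <= k <= n.
   The default value 1 of the iterated minima is absorbed by the outer one. *)

Definition ordered_SSS (k : nat) : R :=
  Num.min 1
    (Num.min
       (\big[Num.min/1]_(r < k) (S1 r / (k - r)%:R))
       (\big[Num.min/1]_(r < k.-1) (S2 r / 'C(k - r, 2)%:R))).

Definition BP_index (k r : nat) : int :=
  Num.ceil ((((k - r)%:R - 1) * S1 r - 2 * S2 r) / ((k - r)%:R - S1 r)).

(* BP(n - r, k - r) *)
Definition BP (k r : nat) : R :=
  let i : R := (BP_index k r)%:~R in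
  let d : R := (k - r)%:R - i in
  if k%:R < (((n - r)%:R - 1) * S1 r - 2 * S2 r) / ((n - r)%:R - S1 r) + r%:R
  then 1
  else if k%:R < 1 + 2 * S2 r / S1 r + r%:R
  then ((k%:R + n%:R - 2 * r%:R - 1) * S1 r - 2 * S2 r)
       / ((k - r)%:R * (n - r)%:R)
  else ((i - 1) * (i - 2 * S1 r) + 2 * S2 r) / (d ^+ 2 + d).

(* The default value of the iterated minimum is itself the r = 0 term. *)
Definition ordered_BP (k : nat) : R := \big[Num.min/BP k 0]_(r < k) BP k r.

End OrderedBounds.

(* [v] is the tightest bound, and both ordered bounds attain it. *)
Definition both_tight_with_value (R : realType) (n k : nat) (p q v : R) : Prop :=
  [/\ is_max (tail_probs (@marg_pq R n p q) k) (Pbar n k p q),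
      ordered_SSS (@marg_pq R n p q) k = Pbar n k p q,
      ordered_BP (@marg_pq R n p q) k = Pbar n k p q
    & Pbar n k p q = v].

(* Main.v *)
Require Import Defs.
From mathcomp Require Import all_boot all_order all_fingroup all_algebra.
From mathcomp Require Import reals.
From mathcomp Require Import zify ring lra.

(** Each term of the ordered Schmidt-Siegel-Srinivasan bound is a valid upper
bound on the tail probability for any pairwise independent law, and so is each
term of the ordered Boros-Prekopa bound as soon as S1 r < k - r: it comes from
a polynomial of degree at most 2 that dominates the indicator of [k - r <= y]
at every integer y of [0, n - r], taken at the number y of ones among the n - r
coordinates with the smallest marginals ([tail_prob_le_quadratic]). Pairwise
independence determines the first two moments of y, hence the expectation of
the polynomial. Dropping the r remaining coordinates costs at most r ones.

It therefore suffices to find one law, and one term of each bound, with the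
value v in question: every tail probability is at most either bound, each bound
is at most v, and the law makes all of them equal ([both_tight_of_witness]).

Write N = n - 1. The laws are exchangeable in the first N coordinates; the
number of ones among these takes only the values 0, 1 and K, jointly with the
value of the last coordinate ([three_level]). The total mass and the prescribed
marginals and products amount to five linear equations in the six masses, and
nonnegativity of a solution is what has to be checked.

If p <= q, take K = k - 1. Let v = 'C(N, 2) p^2 / 'C(K, 2) be the mass of level
K, carried by the event that the last coordinate is 1. What this level
contributes to the probability that a given front coordinate and the last one
are both 1 must not exceed p q, that is (n - 2) p <= (k - 2) q. Both (a) and
(b) imply it. The terms with r = 1, which drop the last coordinate, equal v;
for the Boros-Prekopa term this is the third case with i = 1 ([BP_index1]).

If q < p and k = n, take K = N. When the last coordinate is 1, the others are
all 1 (mass p q) or all 0. The terms with r = n - 2, which retain the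
coordinate of marginal q and one of marginal p, equal p q. *)

Set Implicit Arguments.
Unset Strict Implicit.
Unset Printing Implicit Defensive.

Import Order.TTheory GRing.Theory Num.Theory.
Local Open Scope ring_scope.

(** * Moments and quadratic majorants of the tail *)

(** [expectation theta f] is the mean of [f] under the mass function [theta]. *)
Definition expectation {R : realType} {n : nat}
    (theta : {ffun {ffun 'I_n -> bool} -> R}) (f : {ffun 'I_n -> bool} -> R) : R :=
  \sum_c theta c * f c.

Lemma double_sum_lt (R : comNzRingType) (m : nat) (a : 'I_m -> R) :
  2 * \sum_(i < m) \sum_(j < m | (i < j)%N) a i * a j
  = (\sum_(i < m) a i) ^+ 2 - \sum_(i < m) a i ^+ 2.
Proof.
elim: m a => [|m IHm] a; first by rewrite !big_ord0 mulr0 expr0n subrr.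
rewrite !big_ord_recr /=.
rewrite [X in _ * (_ + X)]big1 => [|j lt_mj]; last first.
  by move: lt_mj (ltn_ord j); rewrite ltnS ltnNge => /negbTE->.
rewrite addr0.
under eq_bigr => i _.
  rewrite big_mkcond big_ord_recr /= ltn_ord -big_mkcond /=.
  over.
rewrite big_split /= mulrDr IHm -mulr_suml; ring.
Qed.

(** No integer lies strictly between -1 and 0. *)
Lemma intr_mulr_succ_ge0 (R : numDomainType) (z : int) : 0 <= z%:~R * (z%:~R + 1) :> R.
Proof.
have : 0 <= z * (z + 1) by have [z0|z0] := leP 0 z; nia.
by rewrite -(ler0z R) rmorphM rmorphD.
Qed.

Lemma bin2E (R : numFieldType) (K : nat) : 'C(K, 2)%:R = K%:R * (K%:R - 1) / 2 :> R.
Proof.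
case: K => [|K]; first by rewrite bin0n !mul0r.
have /(congr1 (fun x : nat => x%:R : R)) : ('C(K.+1, 2) * 2 = K.+1 * K)%N.
  by rewrite mulnC -mul_bin_diag bin1.
rewrite !natrM => binE; apply: (@mulIf _ (2 : R)); first by rewrite pnatr_eq0.
by rewrite binE -[K.+1]addn1 natrD; field.
Qed.

Section Moments.
Variables (R : realType) (n : nat) (marg : 'I_n -> R).
Variable theta : {ffun {ffun 'I_n -> bool} -> R}.
Hypothesis theta_pi : pairwise_indep_with marg theta.

Lemma prob_expectation E : prob theta E = expectation theta (fun c => (E c)%:R).
Proof.
rewrite /prob /expectation big_mkcond; apply: eq_bigr => c _.
by case: (E c); rewrite ?mulr1 ?mulr0.
Qed.

Lemma expectation_sum (I : finType) (P : pred I) (f : I -> {ffun 'I_n -> bool} -> R) :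
  expectation theta (fun c => \sum_(i | P i) f i c)
  = \sum_(i | P i) expectation theta (f i).
Proof.
rewrite /expectation exchange_big /=; apply: eq_bigr => c _.
by rewrite mulr_sumr.
Qed.

(** The sorting permutation of the marginals; it turns the partial sums of the
    sorted list into sums over genuine coordinates. *)
Lemma sorted_marg_perm :
  exists s : {perm 'I_n}, forall i : 'I_n, (sorted_marg marg)`_i = marg (s i).
Proof.
have szE : size [seq marg i | i <- enum 'I_n] == n by rewrite size_map size_enum_ord.
have /tuple_permP[s sE] : perm_eq (sorted_marg marg) (Tuple szE).
  by rewrite perm_sort.
exists s => i.
rewrite sE (nth_map i) ?size_enum_ord // nth_ord_enum (tnth_nth 0) /=.
by rewrite (nth_map i) ?size_enum_ord // nth_ord_enum.
Qed.

(** Here y stands for the number of ones among the n - r coordinates with the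
    smallest marginals; its mean is [S1 marg r], and the mean of y (y - 1) is
    [2 * S2 marg r]. *)
Lemma tail_prob_le_quadratic (k r : nat) (a b d : R) : (r <= n)%N ->
    (forall y : nat, (y <= n - r)%N ->
       (k - r <= y)%N%:R <= a + b * y%:R + d * (y%:R * (y%:R - 1))) ->
  tail_prob k theta <= a + b * S1 marg r + d * (2 * S2 marg r).
Proof.
move=> le_rn majorant; have [[theta_ge0 theta1] theta_m theta_p] := theta_pi.
have [s sE] := sorted_marg_perm.
have le_m : (n - r <= n)%N by exact: leq_subr.
pose w := widen_ord le_m.
(* The number of ones among the n - r coordinates of smallest marginal. *)
pose Y (c : {ffun 'I_n -> bool}) := (\sum_(i < n - r) c (s (w i)))%N.
have Y_le (c : {ffun 'I_n -> bool}) : (Y c <= n - r)%N.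
  rewrite -[leqRHS]card_ord -sum1_card; apply: leq_sum => i _.
  by case: (c _).
have tail_Y (c : {ffun 'I_n -> bool}) : (k <= \sum_(i < n) c i)%N -> (k - r <= Y c)%N.
  rewrite (reindex_inj (@perm_inj _ s)) /=.
  rewrite (bigID (fun i : 'I_n => (i < n - r)%N)) /= (big_ord_narrow le_m).
  move=> k_le; rewrite leq_subLR (leq_trans k_le) // addnC leq_add2r.
  have rE : (\sum_(i < n | ~~ (i < n - r)) 1)%N = r.
    have : (\sum_(i < n) 1 = n)%N by rewrite sum1_card card_ord.
    rewrite (bigID (fun i : 'I_n => (i < n - r)%N)) /= (big_ord_narrow le_m).
    by rewrite sum1_card card_ord => sumE; apply: (@addnI (n - r)%N); rewrite sumE subnK.
  by rewrite -[leqRHS]rE; apply: leq_sum => i _; case: (c _).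
have EY : expectation theta (fun c => (Y c)%:R) = S1 marg r.
  transitivity (expectation theta (fun c => \sum_(i < n - r) (c (s (w i)))%:R)).
    by apply: eq_bigr => c _; rewrite /Y natr_sum.
  rewrite expectation_sum; apply: eq_bigr => i _.
  by rewrite -(prob_expectation (fun c => c (s (w i)))) theta_m -sE.
have EYY : expectation theta (fun c => (Y c)%:R * ((Y c)%:R - 1)) = 2 * S2 marg r.
  (* Y is a sum of idempotents, so that Y (Y - 1) is the square of the sum minus
     the sum of the squares. *)
  transitivity (expectation theta (fun c =>
      \sum_(i < n - r) \sum_(j < n - r | (i < j)%N)
        2 * (c (s (w i)) && c (s (w j)))%:R)).
    apply: eq_bigr => c _; congr (_ * _).
    rewrite mulrBr mulr1 -expr2 /Y natr_sum.
    under [X in _ - X]eq_bigr => i _.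
      have -> : (c (s (w i)))%:R = (c (s (w i)))%:R ^+ 2 :> R.
        by case: (c _); rewrite ?expr1n ?expr0n.
      over.
    rewrite -double_sum_lt mulr_sumr; apply: eq_bigr => i _.
    rewrite mulr_sumr; apply: eq_bigr => j _.
    by rewrite -mulnb natrM.
  rewrite expectation_sum mulr_sumr; apply: eq_bigr => i _.
  rewrite expectation_sum mulr_sumr; apply: eq_bigr => j lt_ij.
  rewrite /expectation.
  under eq_bigr do rewrite mulrCA.
  rewrite -mulr_sumr; congr (_ * _).
  rewrite -/(expectation theta (fun c => (c (s (w i)) && c (s (w j)))%:R)).
  rewrite -(prob_expectation (fun c => c (s (w i)) && c (s (w j)))).
  rewrite (sE (w i)) (sE (w j)).
  have [lt_s|lt_s|/val_inj/perm_inj/(congr1 val)/= eq_s] :=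
      ltngtP (s (w i)) (s (w j)).
  - by rewrite theta_p.
  - rewrite mulrC -theta_p // /prob; apply: eq_bigl => c; exact: andbC.
  - by move: lt_ij; rewrite eq_s ltnn.
have -> : a + b * S1 marg r + d * (2 * S2 marg r)
        = expectation theta (fun c =>
            a + b * (Y c)%:R + d * ((Y c)%:R * ((Y c)%:R - 1))).
  rewrite -EY -EYY -[a in LHS]mulr1 -theta1 /expectation !mulr_sumr -!big_split /=.
  by apply: eq_bigr => c _; ring.
rewrite /tail_prob prob_expectation; apply: ler_sum => c _.
rewrite ler_wpM2l // (le_trans _ (majorant _ (Y_le c))) // ler_nat.
by case: (leqP k) => // /tail_Y ->.
Qed.

(** * Validity of the ordered bounds *)

Lemma tail_prob_ge0 (k : nat) : 0 <= tail_prob k theta.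
Proof. by have [[theta_ge0 _] _ _] := theta_pi; apply: sumr_ge0. Qed.

Lemma tail_prob_le1 (k : nat) : tail_prob k theta <= 1.
Proof.
have [[theta_ge0 <-] _ _] := theta_pi.
rewrite /tail_prob /prob big_mkcond; apply: ler_sum => c _.
by case: ifP.
Qed.

Lemma tail_prob_le_S1 (k r : nat) : (r < k)%N -> (k <= n)%N ->
  tail_prob k theta <= S1 marg r / (k - r)%:R.
Proof.
move=> lt_rk le_kn.
have K_gt0 : 0 < (k - r)%:R :> R by rewrite ltr0n subn_gt0.
have := @tail_prob_le_quadratic k r 0 (k - r)%:R^-1 0.
rewrite add0r mul0r addr0 mulrC; apply; first exact: (leq_trans (ltnW lt_rk)).
move=> y _; rewrite add0r mul0r addr0 mulrC ler_pdivlMr //.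
by case: leqP => le_Ky; rewrite ?mul0r ?mul1r ?ler0n ?ler_nat.
Qed.

Lemma tail_prob_le_S2 (k r : nat) : (r < k.-1)%N -> (k <= n)%N ->
  tail_prob k theta <= S2 marg r / 'C(k - r, 2)%:R.
Proof.
move=> lt_rk le_kn.
have B_gt0 : 0 < 'C(k - r, 2)%:R :> R by rewrite ltr0n bin_gt0; lia.
have := @tail_prob_le_quadratic k r 0 0 (2 * 'C(k - r, 2)%:R)^-1.
have -> : 0 + 0 * S1 marg r + (2 * 'C(k - r, 2)%:R)^-1 * (2 * S2 marg r)
        = S2 marg r / 'C(k - r, 2)%:R.
  by field; rewrite gt_eqF.
apply; first lia.
move=> y _; rewrite mul0r !add0r mulrC.
have -> : y%:R * (y%:R - 1) = 2 * 'C(y, 2)%:R :> R by rewrite bin2E; field.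
rewrite ler_pdivlMr ?mulr_gt0 //; case: leqP => le_Ky.
  by rewrite mul1r ler_pM2l // ler_nat leq_bin2l.
by rewrite mul0r mulr_ge0.
Qed.

Lemma tail_prob_le_SSS (k : nat) : (k <= n)%N ->
  tail_prob k theta <= ordered_SSS marg k.
Proof.
move=> le_kn; rewrite /ordered_SSS !le_min tail_prob_le1 /=.
by apply/andP; split; apply: le_bigmin; rewrite ?tail_prob_le1 // => r _;
  [apply: tail_prob_le_S1|apply: tail_prob_le_S2].
Qed.

(** The mean of (K - y) (K - 1 - y), where K = k - r, is nonnegative because y is
    an integer.  This keeps the index i of the third case below K, so that the
    denominator of that case is positive. *)
Lemma BP_index_le (k r : nat) : (r < k)%N -> (k <= n)%N ->
    S1 marg r < (k - r)%:R ->
  BP_index marg k r <= (k - r)%:Z - 1.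
Proof.
move=> lt_rk le_kn S1_lt.
rewrite /BP_index ceil_le_int rmorphB /= ler_pdivrMr ?subr_gt0 //.
set K : R := (k - r)%:R.
(* The threshold n + 1 is never reached: the majorant only has to be nonnegative. *)
have := @tail_prob_le_quadratic n.+1 r (K * (K - 1)) (- (2 * (K - 1))) 1.
move=> /(_ _ _)/(le_trans (tail_prob_ge0 _)) quad_ge0.
suff : 0 <= K * (K - 1) + - (2 * (K - 1)) * S1 marg r + 1 * (2 * S2 marg r) by lra.
apply: quad_ge0 => [|y le_y]; first lia.
have -> : (n.+1 - r <= y)%N = false by lia.
have := intr_mulr_succ_ge0 R (y%:Z - (k - r)%:Z).
by rewrite rmorphB /= -/K /=; lra.
Qed.

(** The majorants are, with K = k - r and m = n - r, the polynomial
    y (K + m - y) / (K m) in the second case and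
    (y - i) (y - i + 1) / ((K - i) (K - i + 1)) in the third. *)
Lemma tail_prob_le_BP (k r : nat) : (r < k)%N -> (k <= n)%N ->
    S1 marg r < (k - r)%:R ->
  tail_prob k theta <= BP marg k r.
Proof.
move=> lt_rk le_kn S1_lt; have le_rn : (r <= n)%N by lia.
have K_gt0 : 0 < (k - r)%:R :> R by rewrite ltr0n subn_gt0.
rewrite /BP; case: ifP => _; first exact: tail_prob_le1.
case: ifP => _.
  have m_gt0 : 0 < (n - r)%:R :> R by rewrite ltr0n; lia.
  set D := (k - r)%:R * (n - r)%:R.
  have D_gt0 : 0 < D by rewrite mulr_gt0.
  have := @tail_prob_le_quadratic k r 0 (((k - r)%:R + (n - r)%:R - 1) / D) (- D^-1) le_rn.
  move=> /(_ _)/le_trans; apply; last first.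
    by rewrite !natrB ?(ltnW lt_rk) // le_eqVlt; apply/orP; left; apply/eqP; ring.
  move=> y le_y.
  have -> : 0 + ((k - r)%:R + (n - r)%:R - 1) / D * y%:R
            + - D^-1 * (y%:R * (y%:R - 1))
          = y%:R * ((k - r)%:R + (n - r)%:R - y%:R) / D by ring.
  have le_yR : y%:R <= (n - r)%:R :> R by rewrite ler_nat.
  have y_ge0 : 0 <= y%:R :> R by [].
  rewrite ler_pdivlMr // /D.
  case: leqP => [|_]; last by rewrite mul0r mulr_ge0 //; lra.
  rewrite -(ler_nat R) mul1r => le_Ky; rewrite -subr_ge0.
  have -> : y%:R * ((k - r)%:R + (n - r)%:R - y%:R) - (k - r)%:R * (n - r)%:R
          = (y%:R - (k - r)%:R) * ((n - r)%:R - y%:R) :> R by ring.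
  by rewrite mulr_ge0 ?subr_ge0.
have := BP_index_le lt_rk le_kn S1_lt.
set i := BP_index marg k r => i_le.
set d : R := (k - r)%:R - i%:~R.
have d_ge1 : 1 <= d.
  by move: i_le; rewrite -(ler_int R) rmorphB /= /d /=; lra.
have D_gt0 : 0 < d ^+ 2 + d by rewrite ltr_pwDr ?sqr_ge0 //; lra.
set D := d ^+ 2 + d in D_gt0 *.
have := @tail_prob_le_quadratic k r (i%:~R * (i%:~R - 1) / D)
          (- (2 * (i%:~R - 1)) / D) D^-1 le_rn.
move=> /(_ _)/le_trans; apply; last first.
  by rewrite le_eqVlt; apply/orP; left; apply/eqP; ring.
move=> y le_y.
have -> : i%:~R * (i%:~R - 1) / D + - (2 * (i%:~R - 1)) / D * y%:R
          + D^-1 * (y%:R * (y%:R - 1))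
        = ((y%:R - i%:~R) * ((y%:R - i%:~R) + 1)) / D by ring.
rewrite ler_pdivlMr //.
case: leqP => [|_]; last first.
  by rewrite mul0r; have := intr_mulr_succ_ge0 R (y%:Z - i); rewrite rmorphB.
rewrite -(ler_nat R) mul1r => le_Ky.
have -> : D = d * (d + 1) by rewrite /D; ring.
have le_d : d <= y%:R - i%:~R by rewrite lerD2r.
by rewrite ler_pM ?lerD2r //; lra.
Qed.

Lemma tail_prob_le_ordered_BP (k : nat) : (0 < k <= n)%N ->
    (forall r, (r < k)%N -> S1 marg r < (k - r)%:R) ->
  tail_prob k theta <= ordered_BP marg k.
Proof.
move=> /andP[k_gt0 le_kn] S1_lt; apply: le_bigmin => [|r _]; apply: tail_prob_le_BP => //;
  exact: S1_lt.
Qed.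

End Moments.

(** As every tail probability is at most either bound, a law whose tail
    probability is at least [v] and bounds that are at most [v] give equality
    throughout. *)
Lemma both_tight_of_witness (R : realType) (n k : nat) (p q v : R)
    (theta : {ffun {ffun 'I_n -> bool} -> R}) :
    (0 < k <= n)%N ->
    (forall r, (r < k)%N -> S1 (@marg_pq R n p q) r < (k - r)%:R) ->
    ordered_SSS (@marg_pq R n p q) k <= v ->
    ordered_BP (@marg_pq R n p q) k <= v ->
    pairwise_indep_with (@marg_pq R n p q) theta ->
    v <= tail_prob k theta ->
  both_tight_with_value n k p q v.
Proof.
move=> /[dup] k_range /andP[_ le_kn] S1_lt SSS_le BP_le theta_pi le_tail.
have SSS_ge t : tail_probs (@marg_pq R n p q) k t -> t <= v.
  by move=> [u u_pi <-]; apply: le_trans (tail_prob_le_SSS u_pi le_kn) SSS_le.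
have tail_v : tail_probs (@marg_pq R n p q) k v.
  exists theta => //; apply/eqP; rewrite eq_le le_tail andbT.
  by apply: SSS_ge; exists theta.
have PbarE : Pbar n k p q = v.
  apply/eqP; rewrite eq_le; apply/andP; split.
    by apply: ge_sup; first by exists v.
  by apply: ub_le_sup => //; exists v.
rewrite /both_tight_with_value PbarE; split => //.
  apply/eqP; rewrite eq_le SSS_le /= (le_trans le_tail) //.
  exact: tail_prob_le_SSS.
apply/eqP; rewrite eq_le BP_le /= (le_trans le_tail) //.
exact: tail_prob_le_ordered_BP.
Qed.

(** * The sorted marginals and their sums *)

Lemma map_marg_pq (R : realType) (N : nat) (p q : R) :
  [seq marg_pq p q i | i <- enum 'I_N.+1] = rcons (nseq N p) q.
Proof.
apply: (@eq_from_nth _ 0) => [|i].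
  by rewrite size_map size_enum_ord size_rcons size_nseq.
rewrite size_map size_enum_ord => lt_i.
rewrite (nth_map ord0) ?size_enum_ord // /marg_pq nth_enum_ord //=.
rewrite nth_rcons size_nseq nth_nseq.
by case: eqVneq => [->|ne_iN]; rewrite ?ltnn // ltn_neqAle ne_iN -ltnS lt_i.
Qed.

Lemma sorted_marg_pq_le (R : realType) (N : nat) (p q : R) : p <= q ->
  sorted_marg (@marg_pq R N.+1 p q) = rcons (nseq N p) q.
Proof.
move=> le_pq; rewrite /sorted_marg map_marg_pq sort_le_id //.
case: N => [|N] //=.
by elim: N => [|N IHN] /=; rewrite ?le_pq ?lexx.
Qed.

Lemma sorted_marg_pq_gt (R : realType) (N : nat) (p q : R) : q < p ->
  sorted_marg (@marg_pq R N.+1 p q) = q :: nseq N p.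
Proof.
move=> lt_qp; rewrite /sorted_marg map_marg_pq.
have /perm_sort_leP-> : perm_eq (rcons (nseq N p) q) (q :: nseq N p).
  by rewrite perm_rcons.
rewrite sort_le_id //=.
case: N => [|N] //=; rewrite ltW //=.
by elim: N => //= N ->; rewrite lexx.
Qed.

Lemma S1_pq_le (R : realType) (N r : nat) (p q : R) : p <= q -> (0 < r)%N ->
  S1 (@marg_pq R N.+1 p q) r = (N.+1 - r)%:R * p.
Proof.
move=> le_pq r_gt0; rewrite /S1 sorted_marg_pq_le //.
rewrite (eq_bigr (fun=> p)) => [|i _].
  by rewrite sumr_const card_ord mulr_natl.
by rewrite nth_rcons size_nseq nth_nseq; have -> : (i < N)%N by have := ltn_ord i; lia.
Qed.

Lemma S1_pq_le0 (R : realType) (N : nat) (p q : R) : p <= q ->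
  S1 (@marg_pq R N.+1 p q) 0 = N%:R * p + q.
Proof.
move=> le_pq; rewrite /S1 sorted_marg_pq_le // subn0 big_ord_recr /=.
rewrite nth_rcons size_nseq ltnn eqxx; congr (_ + _).
rewrite (eq_bigr (fun=> p)) => [|i _].
  by rewrite sumr_const card_ord mulr_natl.
by rewrite nth_rcons size_nseq nth_nseq ltn_ord.
Qed.

Lemma S2_pq_le1 (R : realType) (N : nat) (p q : R) : p <= q ->
  S2 (@marg_pq R N.+1 p q) 1 = 'C(N, 2)%:R * p ^+ 2.
Proof.
move=> le_pq; apply: (@mulfI _ (2 : R)); rewrite ?pnatr_eq0 // /S2 double_sum_lt.
rewrite -/(S1 (@marg_pq R N.+1 p q) 1) S1_pq_le // subSS subn0 bin2E.
under eq_bigr => i _.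
  rewrite sorted_marg_pq_le // nth_rcons size_nseq nth_nseq.
  rewrite ltn_ord.
  over.
by rewrite sumr_const card_ord -[_ *+ _]mulr_natl; field.
Qed.

Lemma S1_pq_gt_bound (R : realType) (N r : nat) (p q : R) : q < p -> p <= 1 -> q < 1 ->
  (r <= N)%N -> S1 (@marg_pq R N.+1 p q) r < (N.+1 - r)%:R.
Proof.
move=> lt_qp p_le1 q_lt1 le_rN; rewrite /S1 sorted_marg_pq_gt // subSn //.
rewrite big_ord_recl /= -[in ltRHS]addn1 natrD addrC.
apply: ler_ltD => //.
rewrite -[X in _ <= X%:R]card_ord -sum1_card natr_sum; apply: ler_sum => i _.
by rewrite nth_nseq /=; case: ifP.
Qed.

Lemma S1S2_pq_gt (R : realType) (N : nat) (p q : R) : q < p -> (0 < N)%N ->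
  S1 (@marg_pq R N.+1 p q) N.-1 = q + p /\
  S2 (@marg_pq R N.+1 p q) N.-1 = q * p.
Proof.
case: N => // N lt_qp _; rewrite /S1 /S2 sorted_marg_pq_gt //.
have -> : (N.+2 - N.+1.-1 = 2)%N by lia.
split; first by rewrite !big_ord_recl big_ord0 /= addr0.
apply: (@mulfI _ (2 : R)); rewrite ?pnatr_eq0 // double_sum_lt.
by rewrite !big_ord_recl !big_ord0 /=; ring.
Qed.

(** * Laws that are exchangeable in the first N coordinates *)

Lemma bin_ffactM (n m b : nat) : (b <= m)%N -> (m <= n)%N ->
  ('C(n, m) * m ^_ b = n ^_ b * 'C(n - b, m - b))%N.
Proof.
move=> le_bm le_mn; elim: b le_bm => [|b IHb] lt_bm.
  by rewrite !ffactn0 !subn0 muln1 mul1n.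
rewrite !ffactnSr mulnA IHb ?(ltnW lt_bm) // -!mulnA; congr (_ * _)%N.
rewrite !subnS mulnC.
by rewrite -{1 2}(prednK (_ : 0 < m - b)%N) ?subn_gt0 // mul_bin_diag.
Qed.

Section Levels.
Variables (R : realType) (N : nat).
Local Notation outcome := {ffun 'I_N.+1 -> bool}.
Implicit Types (c : outcome) (B : {set 'I_N.+1}).

(** The set of ones of [c] among the first N coordinates. *)
Definition front c : {set 'I_N.+1} := [set i | c i & i != ord_max].

(** The outcomes counted are those with last coordinate [e] and with x ones among
    the first N coordinates, all of [B] included. *)
Lemma card_level B (x : nat) (e : bool) :
    ord_max \notin B -> (#|B| <= x)%N ->
  #|[set c : outcome | (c ord_max == e) && (#|front c| == x) && (B \subset front c)]|
  = 'C(N - #|B|, x - #|B|).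
Proof.
move=> maxB le_Bx.
(* Such an outcome is determined by the ones outside B, an arbitrary set of
   x - #|B| coordinates among the other first ones. *)
pose F (A : {set 'I_N.+1}) : outcome :=
  [ffun i => if i == ord_max then e else i \in A :|: B].
pose D := [set A : {set 'I_N.+1} |
             (A \subset ~: (ord_max |: B)) && (#|A| == x - #|B|)%N].
have frontF A : A \in D -> front (F A) = A :|: B.
  rewrite inE => /andP[/subsetP A_sub _]; apply/setP => i; rewrite !inE ffunE.
  case: eqVneq => [->|_]; last by rewrite andbT inE.
  rewrite andbF (negbTE maxB) orbF; apply/esym/negbTE/negP => /A_sub.
  by rewrite !inE eqxx.
have disjD A : A \in D -> A :&: B = set0.
  rewrite inE => /andP[/subsetP A_sub _]; apply/setP => i; rewrite !inE.
  by apply/negbTE/negP => /andP[/A_sub]; rewrite !inE negb_or => /andP[_ /negbTE->].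
have -> : [set c : outcome | (c ord_max == e) && (#|front c| == x) && (B \subset front c)]
        = [set F A | A in D].
  apply/setP => c; rewrite inE; apply/idP/imsetP => [/andP[/andP[/eqP c_e /eqP c_x] Bc]|].
    exists (front c :\: B); last first.
      apply/ffunP => i; rewrite ffunE; case: eqVneq => [-> //|i_max].
      rewrite !inE i_max andbT.
      have := subsetP Bc i; rewrite inE i_max andbT.
      by case: (i \in B) => [->|_] //=; rewrite orbF.
    rewrite inE cardsDS // c_x eqxx andbT.
    apply/subsetP => i; rewrite !inE negb_or.
    by case/andP => -> /andP[_ ->].
  move=> [A A_D ->]; rewrite (frontF A A_D) subsetUr andbT.
  rewrite /F ffunE eqxx eqxx /= cardsU disjD // cards0 subn0.
  by move: A_D; rewrite inE => /andP[_ /eqP->]; rewrite subnK.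
rewrite card_in_imset => [|A1 A2 A1_D A2_D eqF].
  rewrite cards_draws; congr 'C(_, _).
  by rewrite cardsCs setCK card_ord cardsU1 maxB subSS.
have := congr1 front eqF; rewrite !frontF // => /(congr1 (fun A => A :\: B)).
rewrite !setDUl setDv !setU0.
by rewrite -(setID A1 B) -(setID A2 B) !disjD // !set0U
  !setDDl !setUid.
Qed.

(** The uniform law on the outcomes with [x] ones among the first N coordinates
    and last coordinate [e]; it is a probability when [x <= N]. *)
Definition level (x : nat) (e : bool) : {ffun outcome -> R} :=
  [ffun c : outcome => ((c ord_max == e) && (#|front c| == x))%:R / 'C(N, x)%:R].

Lemma level_ge0 x e c : 0 <= level x e c.
Proof. by rewrite ffunE divr_ge0. Qed.

(** The falling factorials vanish for x < #|B|, as does the probability. *)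
Lemma prob_level_subset (x : nat) (e : bool) B : (x <= N)%N -> ord_max \notin B ->
  prob (level x e) (fun c => B \subset front c) = (x ^_ #|B|)%:R / (N ^_ #|B|)%:R.
Proof.
move=> le_xN maxB.
have le_BN : (#|B| <= N)%N.
  rewrite -ltnS -[ltnRHS]card_ord -(cardsC B) -addn1 leq_add2l card_gt0.
  by apply/set0Pn; exists ord_max; rewrite inE.
have N_neq0 : (N ^_ #|B|)%:R != 0 :> R by rewrite pnatr_eq0 -lt0n ffact_gt0.
have C_neq0 : 'C(N, x)%:R != 0 :> R by rewrite pnatr_eq0 -lt0n bin_gt0.
transitivity (#|[set c : outcome | (c ord_max == e) && (#|front c| == x)
                                   && (B \subset front c)]|%:R / 'C(N, x)%:R : R).
  rewrite /prob -sum1_card natr_sum mulr_suml [LHS]big_mkcond [RHS]big_mkcond.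
  apply: eq_bigr => c _; rewrite inE ffunE.
  by case: (B \subset _); rewrite ?andbT ?andbF //; case: (_ && _); rewrite ?mul0r.
have [le_Bx|lt_xB] := leqP #|B| x.
  rewrite card_level //; apply/eqP; rewrite eqr_div // -!natrM [in eqbRHS]mulnC.
  by rewrite bin_ffactM // mulnC.
rewrite ffact_small // mul0r -sum1_card big_pred0 ?mul0r // => c.
rewrite inE; apply/negbTE; apply: contraTN lt_xB => /andP[/andP[_ /eqP<-]].
by move/subset_leq_card; rewrite -leqNgt.
Qed.

Lemma prob_level_last (x : nat) (e : bool) (E : pred outcome) :
  prob (level x e) (fun c => E c && c ord_max) = e%:R * prob (level x e) E.
Proof.
rewrite /prob mulr_sumr [LHS]big_mkcond [RHS]big_mkcond.
apply: eq_bigr => c _; rewrite ffunE.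
by case: (E c) => //=; case: (c ord_max); case: e => //=; rewrite ?mul0r ?mul1r ?mulr0.
Qed.

Lemma prob_ext (theta : {ffun outcome -> R}) (E E' : pred outcome) :
  E =1 E' -> prob theta E = prob theta E'.
Proof. by move=> eqE; apply: eq_bigl. Qed.

(** The mixture of the levels 0, 1 and [K] with masses [z e], [s e] and [t e],
    where [e] is the last coordinate.  The levels may coincide: if [K] is 1, the
    masses [s e] and [t e] add up. *)
Definition three_level (K : nat) (z s t : bool -> R) : {ffun outcome -> R} :=
  [ffun c => \sum_(e : bool) (z e * level 0 e c + s e * level 1 e c + t e * level K e c)].

Lemma prob_three_level (K : nat) (z s t : bool -> R) (E : pred outcome) :
  prob (three_level K z s t) E
  = \sum_(e : bool) (z e * prob (level 0 e) E + s e * prob (level 1 e) E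
                     + t e * prob (level K e) E).
Proof.
rewrite /prob; under eq_bigr do rewrite ffunE.
by rewrite exchange_big /=; apply: eq_bigr => e _; rewrite !big_split /= -!mulr_sumr.
Qed.

Section ThreeLevels.
Variables (p q : R) (K : nat) (z s t : bool -> R).
Hypotheses (K_gt0 : (0 < K)%N) (le_KN : (K <= N)%N).
Hypotheses (z_ge0 : forall e, 0 <= z e) (s_ge0 : forall e, 0 <= s e)
  (t_ge0 : forall e, 0 <= t e).

Let theta := three_level K z s t.

Lemma prob_three_level_subset (B : {set 'I_N.+1}) : ord_max \notin B ->
  prob theta (fun c => B \subset front c)
  = \sum_(e : bool) (z e * (0 ^_ #|B|)%:R + s e * (1 ^_ #|B|)%:R
                     + t e * (K ^_ #|B|)%:R) / (N ^_ #|B|)%:R.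
Proof.
move=> maxB; rewrite prob_three_level; apply: eq_bigr => e _.
by rewrite !prob_level_subset ?(leq_trans K_gt0) // !mulrDl !mulrA.
Qed.

Lemma prob_three_level_subset_last (B : {set 'I_N.+1}) : ord_max \notin B ->
  prob theta (fun c => (B \subset front c) && c ord_max)
  = (z true * (0 ^_ #|B|)%:R + s true * (1 ^_ #|B|)%:R
     + t true * (K ^_ #|B|)%:R) / (N ^_ #|B|)%:R.
Proof.
move=> maxB; rewrite prob_three_level.
rewrite (eq_bigr (fun e : bool => if e then
  (z true * (0 ^_ #|B|)%:R + s true * (1 ^_ #|B|)%:R
     + t true * (K ^_ #|B|)%:R) / (N ^_ #|B|)%:R else 0)).
  by rewrite big_bool /= addr0.
move=> e _; rewrite !prob_level_last !prob_level_subset ?(leq_trans K_gt0) //.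
by case: e; rewrite ?mul0r ?mulr0 ?addr0 // !mul1r !mulrDl !mulrA.
Qed.

(** The hypotheses are, in order: the total mass, the mean number of ones among
    the first N coordinates, the marginal of the last coordinate, the mean number
    of ordered pairs of ones among the first N coordinates, and the mean, over
    the event that the last coordinate is 1, of the number of ones among the first
    N coordinates. *)
Lemma pairwise_indep_three_level :
    z true + z false + (s true + s false) + (t true + t false) = 1 ->
    s true + s false + K%:R * (t true + t false) = N%:R * p ->
    z true + s true + t true = q ->
    K%:R * (K%:R - 1) * (t true + t false) = N%:R * (N%:R - 1) * p ^+ 2 ->
    s true + K%:R * t true = N%:R * p * q ->
  pairwise_indep_with (@marg_pq R N.+1 p q) theta.
Proof.
move=> total first last pairs cross.
have N_neq0 : N%:R != 0 :> R by rewrite pnatr_eq0 -lt0n (leq_trans K_gt0).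
have ffact2 (m : nat) : (m ^_ 2)%:R = m%:R * (m%:R - 1) :> R.
  by case: m => [|m]; rewrite ?mul0r // ffactnSr ffactn1 natrM natrB.
have front1 (i : 'I_N.+1) : i != ord_max -> forall c : outcome, c i = ([set i] \subset front c).
  by move=> i_max c; rewrite sub1set inE i_max andbT.
have notin1 (i : 'I_N.+1) : i != ord_max -> ord_max \notin [set i].
  by rewrite inE eq_sym.
split; first split.
- by move=> c; rewrite ffunE; apply: sumr_ge0 => e _; rewrite !addr_ge0 ?mulr_ge0 ?level_ge0.
- transitivity (prob theta (fun c => set0 \subset front c)).
    by apply: eq_bigl => c; rewrite sub0set.
  rewrite prob_three_level_subset ?inE // cards0 !ffactn0 big_bool /= !mulr1 !divr1.
  by rewrite -total; ring.
- move=> i; rewrite /marg_pq /=; case: ifP => [/eqP i_last|/negbT i_last].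
    have -> : i = ord_max by apply: val_inj.
    transitivity (prob theta (fun c => (set0 \subset front c) && c ord_max)).
      by apply: prob_ext => c; rewrite sub0set.
    by rewrite prob_three_level_subset_last ?inE // cards0 !ffactn0 !mulr1 divr1.
  have i_max : i != ord_max by [].
  rewrite (prob_ext _ (front1 i i_max)) prob_three_level_subset ?notin1 //.
  rewrite cards1 !ffactn1 big_bool /= -mulrDl.
  apply: (mulIf N_neq0); rewrite mulfVK // [RHS]mulrC -first; ring.
move=> i j lt_ij.
have i_max : i != ord_max.
  by rewrite neq_ltn /= (leq_trans lt_ij) // -ltnS.
have marg_front (l : 'I_N.+1) : l != ord_max -> marg_pq p q l = p.
  by rewrite -val_eqE /marg_pq /= => /negbTE->.
rewrite (marg_front i) //.
have [-> |j_max] := eqVneq j ord_max.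
  rewrite /marg_pq /= eqxx.
  transitivity (prob theta (fun c => ([set i] \subset front c) && c ord_max)).
    by apply: prob_ext => c; rewrite -front1.
  rewrite prob_three_level_subset_last ?notin1 // cards1 !ffactn1.
  apply: (mulIf N_neq0); rewrite mulfVK // [RHS]mulrC mulrA -cross; ring.
rewrite (marg_front j) //.
have ne_ij : i != j by rewrite neq_ltn lt_ij.
have B2 : #|[set i; j]| = 2%N by rewrite cards2 ne_ij.
transitivity (prob theta (fun c => [set i; j] \subset front c)).
  by apply: prob_ext => c; rewrite subUset !sub1set !inE i_max j_max !andbT.
have N_gt1 : (1 < N)%N.
  have := ltn_ord j; rewrite ltnS leq_eqVlt => /orP[|]; last by move: lt_ij; lia.
  by move: j_max; rewrite -val_eqE /= => /negbTE->.
have NN_neq0 : N%:R * (N%:R - 1) != 0 :> R.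
  by rewrite mulf_neq0 // subr_eq0 pnatr_eq1 gtn_eqF.
rewrite prob_three_level_subset ?inE ?negb_or ?(eq_sym ord_max) ?i_max //.
rewrite B2 !ffact2 big_bool /= -mulrDl.
apply: (mulIf NN_neq0); rewrite mulfVK // -expr2 [RHS]mulrC -pairs; ring.
Qed.

(** Level [K] together with a last coordinate equal to 1 gives K + 1 ones. *)
Lemma tail_three_level_ge : t true <= tail_prob K.+1 theta.
Proof.
have level_K : prob (level K true) (fun c => (K < \sum_(i < N.+1) c i)%N) = 1.
  transitivity (prob (level K true) (fun c => (set0 \subset front c) && c ord_max)).
    rewrite /prob [LHS]big_mkcond [RHS]big_mkcond; apply: eq_bigr => c _.
    rewrite sub0set /= !ffunE.
    case: (boolP (c ord_max)) => c_max /=; last by rewrite mul0r if_same.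
    case: (boolP (#|front c| == K)) => [/eqP c_K|_] /=; last by rewrite mul0r !if_same.
    suff -> : (K < \sum_(i < N.+1) c i)%N by [].
    rewrite (bigD1 ord_max) //= c_max add1n ltnS -c_K -sum1_card.
    rewrite big_mkcond [leqRHS]big_mkcond; apply: leq_sum => i _.
    by rewrite inE; case: (c i); case: eqP.
  rewrite prob_level_last mul1r prob_level_subset ?inE //.
  by rewrite cards0 !ffactn0 divr1.
rewrite /tail_prob prob_three_level big_bool /= level_K mulr1.
have prob_ge0 x e E : 0 <= prob (level x e) E.
  by apply: sumr_ge0 => c _; exact: level_ge0.
rewrite addrAC lerDr !addr_ge0 ?mulr_ge0 //.
Qed.

End ThreeLevels.
End Levels.

(** * Tightness *)

(** Conditions for the third case of the Boros-Prekopa term to hold with i = 1;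
    the value is then the Schmidt-Siegel-Srinivasan term of the second order. *)
Lemma BP_index1 (R : realType) (n k r : nat) (marg : 'I_n -> R) (K := (k - r)%:R : R)
    (m := (n - r)%:R : R) (s1 := S1 marg r) (s2 := S2 marg r) :
    (r < k)%N -> 0 < s1 -> s1 < m -> s1 < K ->
    (m - 1) * s1 - 2 * s2 <= K * (m - s1) ->
    0 < (K - 1) * s1 - 2 * s2 -> (K - 1) * s1 - 2 * s2 <= K - s1 ->
  BP marg k r = s2 / 'C(k - r, 2)%:R.
Proof.
move=> lt_rk s1_gt0 s1_m s1_K below1 index_gt0 index_le1.
have m_s1 : 0 < m - s1 by rewrite subr_gt0.
have K_s1 : 0 < K - s1 by rewrite subr_gt0.
have kE : k%:R = K + r%:R :> R by rewrite /K -natrD subnK // ltnW.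
rewrite /BP -/m -/K -/s1 -/s2 kE.
rewrite ltrD2r ltr_pdivlMr // [_ < (m - 1) * _ - _]ltNge below1 /=.
have -> : (K + r%:R < 1 + 2 * s2 / s1 + r%:R) = false.
  rewrite ltrD2r addrC -ltrBlDr ltr_pdivlMr //.
  by apply/negbTE; rewrite -leNgt; lra.
have -> : BP_index marg k r = 1.
  rewrite /BP_index -/K -/s1 -/s2; apply: ceil_def.
  by rewrite subrr divr_gt0 //= ler_pdivrMr // mul1r.
rewrite subrr mul0r add0r bin2E -/K.
have -> : (K - 1) ^+ 2 + (K - 1) = 2 * (K * (K - 1) / 2) by field.
by rewrite -mulf_div divff ?pnatr_eq0 // mul1r.
Qed.

(** Instances (a) and (b), with n = N + 1 and k = K + 1. *)
Lemma both_tight_le (R : realType) (N K : nat) (p q : R) :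
    (2 <= K <= N)%N -> 0 < p -> N%:R * p <= 1 -> p <= q -> q < 1 ->
    (N%:R - 1) * p <= (K%:R - 1) * q ->
  both_tight_with_value N.+1 K.+1 p q ('C(N, 2)%:R * p ^+ 2 / 'C(K, 2)%:R).
Proof.
move=> /andP[K_ge2 le_KN] p_gt0 Np_le1 le_pq q_lt1 le_pK.
have N_ge2 : (2 <= N)%N by exact: leq_trans le_KN.
have K2 : 2 <= K%:R :> R by rewrite ler_nat.
have N2 : 2 <= N%:R :> R by rewrite ler_nat.
have KN : K%:R <= N%:R :> R by rewrite ler_nat.
set V := _ / _.
have KK_gt0 : 0 < K%:R * (K%:R - 1) :> R by rewrite mulr_gt0; lra.
have VE : K%:R * (K%:R - 1) * V = N%:R * (N%:R - 1) * p ^+ 2.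
  rewrite /V !bin2E; field.
  by rewrite subr_eq0 !gt_eqF //; lra.
have V_ge0 : 0 <= V by rewrite divr_ge0 // mulr_ge0 // sqr_ge0.
have S1_1 : S1 (@marg_pq R N.+1 p q) 1 = N%:R * p.
  by rewrite S1_pq_le // subSS subn0.
pose z (e : bool) := if e then q * (1 - N%:R * p) + (K%:R - 1) * V
                     else (1 - q) * (1 - N%:R * p).
pose s (e : bool) := if e then N%:R * p * q - K%:R * V else N%:R * p * (1 - q).
pose t (e : bool) := if e then V else 0 : R.
(* The only mass whose sign uses the hypothesis relating p and q through K. *)
have st_ge0 : 0 <= N%:R * p * q - K%:R * V.
  rewrite -(pmulr_rge0 _ (_ : 0 < K%:R - 1)); last lra.
  have -> : (K%:R - 1) * (N%:R * p * q - K%:R * V)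
          = N%:R * p * ((K%:R - 1) * q) - K%:R * (K%:R - 1) * V by ring.
  rewrite VE.
  have -> : N%:R * (N%:R - 1) * p ^+ 2 = N%:R * p * ((N%:R - 1) * p) by ring.
  by rewrite subr_ge0 ler_wpM2l // mulr_ge0 // ltW.
have z_ge0 e : 0 <= z e.
  by case: e; rewrite /z ?addr_ge0 // mulr_ge0 //; lra.
have s_ge0 e : 0 <= s e.
  by case: e; rewrite /s // !mulr_ge0 //; lra.
have t_ge0 e : 0 <= t e by case: e.
apply: (@both_tight_of_witness _ _ _ _ _ _ (three_level N K z s t)).
- by rewrite ltnS.
- case=> [|[|r]] lt_rK.
  + by rewrite S1_pq_le0 // subn0 -addn1 natrD; lra.
  + by rewrite S1_1 subSS subn0; lra.
  rewrite S1_pq_le //.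
  have K_ge1 : 1 <= (K.+1 - r.+2)%:R :> R by rewrite ler1n subn_gt0.
  have : (N.+1 - r.+2)%:R <= N%:R - 1 :> R.
    rewrite lerBrDr -(natrD _ _ 1) ler_nat addn1 subSS ltn_subrL /=.
    exact: leq_trans N_ge2.
  by rewrite -(ler_pM2r p_gt0); lra.
- rewrite /ordered_SSS !ge_min; apply/orP; right; apply/orP; right.
  have lt_1K : (1 < K.+1.-1)%N by [].
  apply: (bigmin_inf (Ordinal lt_1K)) => //=.
  by rewrite S2_pq_le1 // subSS subn0.
- have lt_1K : (1 < K.+1)%N by rewrite ltnS ltnW.
  apply: (bigmin_inf (Ordinal lt_1K)) => //=.
  have p_small : (N%:R - 1) * p < 1 by lra.
  have NpK : N%:R * p * ((N%:R - 1) * p) < N%:R * p * (K%:R - 1).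
    by rewrite ltr_pM2l ?mulr_gt0 //; lra.
  rewrite BP_index1 ?S1_1 ?S2_pq_le1 ?subSS ?subn0 // ?bin2E ?mulr_gt0 //; try lra.
  + suff : N%:R * (1 - p) * ((N%:R - 1) * p) <= N%:R * (1 - p) * K%:R by lra.
    by rewrite ler_wpM2l ?mulr_ge0 //; nra.
  + suff : 0 <= K%:R * (1 - N%:R * p) + N%:R * p * ((N%:R - 1) * p) by lra.
    by rewrite addr_ge0 ?mulr_ge0 //; lra.
- apply: pairwise_indep_three_level => //.
  + exact: ltnW.
  + by rewrite /z /s /t; ring.
  + by rewrite /s /t; ring.
  + by rewrite /z /s /t; ring.
  + by rewrite /t addr0 VE.
  + by rewrite /s /t; ring.
- apply: (@tail_three_level_ge _ N K z s t) => //; exact: ltnW.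
Qed.

(** Instance (c), with n = k = N + 1. *)
Lemma both_tight_gt (R : realType) (N : nat) (p q : R) :
    (0 < N)%N -> 0 < q -> q < p -> N%:R * p <= 1 -> q < 1 ->
  both_tight_with_value N.+1 N.+1 p q (p * q).
Proof.
move=> N_gt0 q_gt0 lt_qp Np_le1 q_lt1.
have p_gt0 : 0 < p by exact: lt_trans lt_qp.
have N1 : 1 <= N%:R :> R by rewrite ler1n.
have p_le1 : p <= 1 by apply: le_trans Np_le1; rewrite ler_peMl // ltW.
have [S1E S2E] := @S1S2_pq_gt R N p q lt_qp N_gt0.
have pq_gt0 : 0 < p * q by rewrite mulr_gt0.
have subE : (N.+1 - N.-1 = 2)%N by lia.
pose z (e : bool) := if e then q * (1 - p)
  else 1 - q - p * (p - q) - N%:R * p * (1 - p).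
pose s (e : bool) := if e then 0 else N%:R * p * (1 - p).
pose t (e : bool) := if e then p * q else p * (p - q).
have z_ge0 e : 0 <= z e.
  case: e; rewrite /z; first by rewrite mulr_ge0 //; lra.
  have -> : 1 - q - p * (p - q) - N%:R * p * (1 - p)
          = (1 - p) * (1 - N%:R * p) + (p - q) * (1 - p) by ring.
  by rewrite addr_ge0 // mulr_ge0 //; lra.
have s_ge0 e : 0 <= s e by case: e; rewrite /s ?mulr_ge0 //; lra.
have t_ge0 e : 0 <= t e by case: e; rewrite /t ?mulr_ge0 //; lra.
apply: (@both_tight_of_witness _ _ _ _ _ _ (three_level N N z s t)).
- by rewrite ltnS leqnn.
- by move=> r lt_rN; apply: S1_pq_gt_bound.
- rewrite /ordered_SSS !ge_min; apply/orP; right; apply/orP; right.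
  have lt_N : (N.-1 < N.+1.-1)%N by rewrite ltn_predL.
  apply: (bigmin_inf (Ordinal lt_N)) => //=.
  by rewrite S2E subE divr1 mulrC.
- have lt_N : (N.-1 < N.+1)%N by lia.
  apply: (bigmin_inf (Ordinal lt_N)) => //=.
  have q1p : 0 < q * (1 - q) by rewrite mulr_gt0 //; lra.
  have pq1 : 0 <= (1 - p) * (1 - q) by rewrite mulr_ge0 //; lra.
  have gap : 0 < q + p - 2 * (q * p).
    have : 0 < p * (1 - q) by rewrite mulr_gt0 //; lra.
    have : 0 <= q * (1 - p) by rewrite mulr_ge0 //; lra.
    lra.
  by rewrite BP_index1 ?S1E ?S2E ?subE // ?divr1; lra.
- apply: pairwise_indep_three_level => //; rewrite /z /s /t; ring.
- exact: (@tail_three_level_ge _ N N z s t).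
Qed.

Unset Implicit Arguments.

Theorem proposition4p5 (R : realType) (n k : nat) (p q : R)
    (hn : (2 <= n)%N) (hk : (k <= n)%N)
    (hp0 : 0 < p) (hp1 : p <= 1 / (n%:R - 1))
    (hq0 : 0 < q) (hq1 : q < 1) :
  [/\ (* (a) *)
      (3 <= k)%N -> (n%:R - 2) * p <= q ->
        both_tight_with_value n k p q
          ('C(n - 1, 2)%:R * p ^+ 2 / 'C(k - 1, 2)%:R),
      (* (b) *)
      Num.ceil (2 + (n%:R - 2) * p / q) <= k%:Z ->
      p <= q -> q < (n%:R - 2) * p ->
        both_tight_with_value n k p q
          ('C(n - 1, 2)%:R * p ^+ 2 / 'C(k - 1, 2)%:R)
    & (* (c) *)
      k = n -> q < p ->
        both_tight_with_value n k p q (p * q)].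
Proof.
case: n hn hk hp1 => [//|N] hn hk hp1.
have nE : N.+1%:R = N%:R + 1 :> R by rewrite -addn1 natrD.
have N_gt0 : 0 < N%:R :> R by rewrite ltr0n.
have Np_le1 : N%:R * p <= 1.
  by move: hp1; rewrite nE addrK ler_pdivlMr // mulrC.
rewrite nE subn1 /=; split.
- case: k hk => [//|K] le_KN K_ge2; rewrite subn1 /= => le_q.
  have K2 : 2 <= K%:R :> R by rewrite ler_nat.
  have N3 : 2 <= N%:R :> R by rewrite ler_nat; lia.
  apply: both_tight_le => //; first by rewrite -ltnS K_ge2.
    by apply: le_trans le_q; rewrite ler_peMl //; lra.
  by rewrite (le_trans (_ : _ <= q)) ?ler_peMl //; lra.
- rewrite ceil_le_int => le_k le_pq lt_q.
  have : (N%:R + 1 - 2) * p <= (k%:R - 2) * q.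
    by rewrite -ler_pdivrMr //; move: le_k => /=; lra.
  have k_gt3 : (3 < k)%N.
    rewrite -(ltr_nat R); apply: lt_le_trans le_k.
    have : 1 < (N%:R + 1 - 2) * p / q by rewrite ltr_pdivlMr // mul1r.
    lra.
  case: k hk le_k k_gt3 => [//|K] le_KN _ K_gt2; rewrite subn1 /= -addn1 natrD => le_pK.
  apply: both_tight_le => //; last lra.
  by apply/andP; split; first exact: ltnW.
move=> -> lt_qp; exact: both_tight_gt.
Qed.
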